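(* For every constant $\varepsilon>0$ there exist a constant $C_\varepsilon$ and an integer $k_0=k_0(\varepsilon)$ such that the following holds for all integers $k\ge k_0$, all integers $\ell$ with $\varepsilon k\le \ell \le k+1$, and all integers $n>C_\varepsilon k$: if $\mathcal{F}\subset \binom{[n]}{k}$ is an intersecting family, then $$d_{\ell+1}(\mathcal{F}) \le \binom{n-2}{k-2} + \binom{n-\ell-1}{k-\ell}.$$
   Context: $[n]=\{1,\dots,n\}$ and $\binom{[n]}{k}$ is the family of all $k$-element subsets of $[n]$. A family $\mathcal{F}$ of sets is intersecting if $|A\cap B|\ge 1$ for all $A,B\in\mathcal{F}$. The degree of $i\in[n]$ in $\mathcal{F}$ is the number of sets $A\in\mathcal{F}$ with $i\in A$. The $n$ degrees of the elements of $[n]$ (counted with multiplicity) are arranged in non-increasing order $d_1(\mathcal{F})\ge d_2(\mathcal{F})\ge\cdots\ge d_n(\mathcal{F})$, so $d_r(\mathcal{F})$ is the $r$-th largest degree. Convention: $\binom{a}{b}=0$ for $b<0$ (relevant when $\ell=k+1$). *)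

(* Defs.v *)
From mathcomp Require Import all_boot all_order all_algebra.
From mathcomp Require Import reals.

Set Implicit Arguments.
Unset Strict Implicit.
Unset Printing Implicit Defensive.

(* Binomial coefficient with an integer lower index, equal to 0 when that
   index is negative; with the truncated subtraction of nat, 'C(n, k - l)
   would be 1 rather than 0 for l = k + 1. *)
Definition binz (a : nat) (b : int) : nat :=
  match b with
  | Posz m => 'C(a, m)
  | Negz _ => 0
  end.

Section Families.
Variable n : nat.
Implicit Types (F : {set {set 'I_n}}) (i : 'I_n).

Definition uniform (k : nat) F : Prop :=
  forall A, A \in F -> #|A| = k.

(* A = B is allowed, so members of an intersecting family are nonempty. *)
Definition intersecting F : Prop :=
  forall A B, A \in F -> B \in F -> 1 <= #|A :&: B|.

Definition degree F i : nat := #|[set A in F | i \in A]|.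

Definition degree_seq F : seq nat :=
  sort geq [seq degree F i | i <- enum 'I_n].

(* r is 1-based; only 1 <= r <= n is meaningful. *)
Definition nth_degree F (r : nat) : nat := nth 0 (degree_seq F) r.-1.

End Families.

(* Main.v *)
Require Import Defs.
From mathcomp Require Import all_boot all_order all_algebra fingroup perm.
From mathcomp Require Import reals.
From mathcomp Require Import zify.

(** Write [N = 'C(n, k)], [P = 'C(n - 2, k - 2)] and [s = n %/ k], a large number,
    so that [P] is about [N / s ^ 2].  Suppose that more than [l] elements have
    degree above the bound.

    There is a centre: some element [i] is avoided by only [O(N / s ^ 2) = O(P)]
    members of [F] ([exists_centre]).  Shifting, which preserves sizes and the
    intersecting property, gives for a pair of cross-intersecting families
    that the first has density [O(1 / s)] or the second has density
    [O(1 / s ^ 2)] ([cross_density]).  So if no element is a centre then every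
    degree is [O(N / s ^ 2)]; walking back along the shifts from a shifted
    family, which has a centre, either a centre survives or [F] itself has only
    [O(N / s ^ 2)] members.

    Fix the centre [i], let [G] be the members avoiding [i], and choose a set [L]
    of [l] elements of large degree, [i] excluded.  For [x] in [L] call a
    [k]-set through [i] and [x] missing if it is not in [F].  As [x] has degree
    above [P + 'C(n - l - 1, k - l)], and as at most ['C(n - l - 1, k - l)]
    members of [G] contain the whole of [L], the missing sets at [x] are fewer
    than the members of [G] that contain [x] but not the whole of [L]
    ([missing_lt]).  The opposite inequality holds on average over [L], and
    this is the contradiction.

    Indeed the members of [G] avoiding [x] cross-intersect the link of [{i, x}].
    If they have density [g], the missing sets have density at least
    [g ^ (1 / r)] among the sets through [i] and [x], for every [r] with about
    [r * k <= n]: a random [k]-set can be drawn together with [r] independent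
    sets disjoint from it, and when it belongs to [G] all [r] are missing
    ([cross_power_bound]).  Since few [k]-sets meet [L] in a positive
    proportion of [L] ([large_traces_rare]) and [G] has [O(P)] members, the
    average degree of [G] on [L] is well below [P].  So for most [x] fewer than
    half of the sets at [x] are missing, and [r = s - 2] makes the part of
    [G] avoiding [x] exponentially small in [s].  Hence [G] is so sparse that already
    [r = 2] yields far more missing sets at [x] than members of [G] avoiding
    [x], for every [x] in [L].  Finally a member of [G] not containing [L] that
    meets [L] in at most half of [L] avoids at least as many elements of [L] as
    it contains, and the others, which are extremely few, avoid at least one. *)

Set Implicit Arguments.
Unset Strict Implicit.
Unset Printing Implicit Defensive.

(** * Counting sets with a prescribed part *)

Lemma card_between (T : finType) (U V : {set T}) k :
  U \subset V -> #|U| <= k ->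
  #|[set A : {set T} | [&& U \subset A, A \subset V & #|A| == k]]|
    = 'C(#|V| - #|U|, k - #|U|).
Proof.
move=> UV Uk.
have <- : #|V :\: U| = #|V| - #|U| by rewrite cardsD (setIidPr UV).
rewrite -cards_draws -[LHS](card_in_imset (f := fun A => A :\: U)); last first.
  move=> A B; rewrite !inE => /and3P[UA _ _] /and3P[UB _ _] eAB.
  by rewrite -(setID A U) -(setID B U) eAB (setIidPr UA) (setIidPr UB).
congr #|pred_of_set _|; apply/setP=> B; apply/imsetP/idP => [[A]|].
  rewrite !inE => /and3P[UA AV /eqP kA] ->.
  by rewrite setSD // cardsD (setIidPr UA) kA eqxx.
rewrite inE subsetD => /andP[/andP[BV dBU] /eqP kB].
exists (U :|: B).
  rewrite inE subsetUl subUset UV BV /= cardsU setIC (disjoint_setI0 dBU) cards0.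
  by apply/eqP; lia.
by rewrite setDUl setDv set0U; apply/esym/setDidPl.
Qed.

(** A [k]-set has density at most [1 / s], and conditioning on the elements
    already known to be in it only lowers this density. *)
Lemma bin_scale s n k u : s * k <= n -> u <= k -> s ^ u * 'C(n - u, k - u) <= 'C(n, k).
Proof.
elim: u n k => [|u IH] n k skn uk; first by rewrite !subn0 mul1n.
case: k skn uk => // k; case: n => [|n] skn uk; first by rewrite leqn0 muln_eq0 orbF in skn; move/eqP: skn => ->; rewrite exp0n.
have h : s * k <= n by case: (s) skn => // s'; rewrite mulnS; lia.
rewrite !subSS expnSr mulnAC.
apply: (@leq_trans ('C(n, k) * s)); first by rewrite leq_mul2r IH ?orbT.
by rewrite -(leq_pmul2l (ltn0Sn k)) -(mul_bin_diag n.+1 k) /= mulnC -mulnA [_ * 'C(_, _)]mulnC leq_mul2l skn orbT.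
Qed.

Lemma card_bigcup_leq (I T : finType) (D : {set I}) (f : I -> {set T}) :
  #|\bigcup_(i in D) f i| <= \sum_(i in D) #|f i|.
Proof.
elim/big_ind2: _ => [|A m B p hA hB|//]; first by rewrite cards0.
by rewrite (leq_trans (leq_card_setU _ _)) ?leq_add.
Qed.

(** Union bound over the [u]-subsets of [W]: a fixed one lies in a random
    [k]-set with probability at most [s ^- u], and there are at most [2 ^ #|W|]
    of them. *)
Lemma card_tail (T : finType) (W : {set T}) s k u :
  s * k <= #|T| ->
  s ^ u * #|[set A : {set T} | (#|A| == k) && (u <= #|A :&: W|)]| <= 2 ^ #|W| * 'C(#|T|, k).
Proof.
move=> skn.
have [ku|uk] := ltnP k u.
  rewrite (_ : [set _ | _] = set0) ?cards0 ?muln0 //.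
  apply/setP=> A; rewrite !inE; apply/negP=> /andP[/eqP kA uA].
  by have := subset_leq_card (subsetIl A W); lia.
pose D := [set U : {set T} | (U \subset W) && (#|U| == u)].
apply: (@leq_trans (s ^ u * \sum_(U in D) 'C(#|T| - u, k - u))).
  rewrite leq_mul2l; apply/orP; right.
  have sub : [set A : {set T} | (#|A| == k) && (u <= #|A :&: W|)] \subset
    \bigcup_(U in D) [set A : {set T} | [&& U \subset A, A \subset setT & #|A| == k]].
    apply/subsetP=> A; rewrite inE => /andP[kA uA].
    have : 0 < #|[set U : {set T} | (U \subset A :&: W) && (#|U| == u)]|.
      by rewrite cards_draws bin_gt0.
    case/card_gt0P=> U; rewrite inE subsetI => /andP[/andP[UA UW] Uu].
    by apply/bigcupP; exists U; rewrite !inE ?UW ?UA ?subsetT.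
  apply: leq_trans (subset_leq_card sub) _.
  apply: leq_trans (card_bigcup_leq _ _) _.
  apply: leq_sum => U; rewrite inE => /andP[_ /eqP uU].
  by rewrite card_between ?subsetT ?uU // cardsT.
rewrite sum_nat_const mulnCA leq_mul ?bin_scale //.
rewrite -card_powerset; apply: subset_leq_card; apply/subsetP=> U.
by rewrite !inE => /andP[].
Qed.

(** * Shifting *)

Definition cross_intersecting (T : finType) (A B : {set {set T}}) : Prop :=
  forall X Y, X \in A -> Y \in B -> X :&: Y != set0.

Section Shift.
Variable n : nat.
Implicit Types (x y : 'I_n) (X Y : {set 'I_n}) (F A B : {set {set 'I_n}}).

(** The elementary shift replaces [x] by [y], for [y < x], in each member of
    the family for which the result is not yet a member. *)
Definition push y x X := if (x \in X) && (y \notin X) then y |: (X :\ x) else X.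

Definition push_in F y x X := if push y x X \in F then X else push y x X.

Definition shift y x F := [set push_in F y x X | X in F].

Definition shifted F := forall x y, y < x -> forall X, X \in F -> push y x X \in F.

(** A moved set is not in [F], so it cannot collide with one that stays. *)
Lemma push_in_inj F y x : {in F &, injective (push_in F y x)}.
Proof.
move=> X Y XF YF; rewrite /push_in.
case: ifP => [_|pX]; case: ifP => [_|pY] //.
- by move=> e; rewrite -e XF in pY.
- by move=> e; rewrite e YF in pX.
move: pX pY; rewrite /push.
case: ifP => [/andP[xX yX] _|_]; last by rewrite XF.
case: ifP => [/andP[xY yY] _|_]; last by rewrite YF.
move=> e; apply/setP=> z; have /setP/(_ z) := e; rewrite !inE.
have [->|zy] := eqVneq z y; first by rewrite (negbTE yX) (negbTE yY).
by have [->|] := eqVneq z x; rewrite ?xX ?xY.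
Qed.

Lemma card_shift F y x : #|shift y x F| = #|F|.
Proof. exact/card_in_imset/push_in_inj. Qed.

Lemma card_push y x X : #|push y x X| = #|X|.
Proof.
rewrite /push; case: ifP => // /andP[xX yX].
by rewrite cardsU1 !inE negb_and yX orbT (cardsD1 x X) xX.
Qed.

Lemma shift_uniform k F y x : uniform k F -> uniform k (shift y x F).
Proof.
move=> Fk _ /imsetP[X XF ->]; rewrite /push_in.
by case: ifP => _; rewrite ?card_push Fk.
Qed.

Lemma mem_shift_avoid F y x X : X \in F -> x \notin X -> X \in shift y x F.
Proof.
move=> XF xX; apply/imsetP; exists X => //.
by rewrite /push_in /push (negbTE xX) /= XF.
Qed.

(** The case of [shift_cross] where [X] moves and [Y] stays.  That [Y] stays
    means that its push is present too, and [X] meets that push in an element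
    which is not lost when [x] is replaced by [y] in [X]. *)
Lemma push_cross_stay A B y x X Y : cross_intersecting A B ->
  X \in A -> push y x X \notin A -> Y \in B -> push y x Y \in B ->
  push y x X :&: Y != set0.
Proof.
move=> AB XA; rewrite {1 3}/push; case: ifP => [/andP[xX yX] _|_]; last by rewrite XA.
move=> YB pY.
have [yY|yY] := boolP (y \in Y).
  by apply/set0Pn; exists y; rewrite !inE eqxx.
have [z] : exists z, z \in X :&: push y x Y by apply/set0Pn/AB.
rewrite /push; case: ifP => [/andP[xY _]|xY]; rewrite !inE => /andP[zX zY].
  apply/set0Pn; exists z; move: zY; rewrite !inE.
  have [zy|zy] /= := eqVneq z y; first by rewrite zy (negbTE yX) in zX.
  by move=> /andP[-> ->]; rewrite zX.
apply/set0Pn; exists z; rewrite !inE zX zY andbT /= andbT.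
apply/orP; right; apply: contraTneq zY => ->.
by move: xY; rewrite yY andbT => ->.
Qed.

Lemma shift_cross A B y x : cross_intersecting A B ->
  cross_intersecting (shift y x A) (shift y x B).
Proof.
move=> AB _ _ /imsetP[X XA ->] /imsetP[Y YB ->]; rewrite /push_in.
case: ifPn => pX; case: ifPn => pY.
- exact: AB.
- rewrite setIC; apply: (@push_cross_stay B A) => // U V UB VA.
  by rewrite setIC AB.
- exact: (push_cross_stay AB).
move: pX pY; rewrite /push.
case: ifP => [_ _|_]; last by rewrite XA.
case: ifP => [_ _|_]; last by rewrite YB.
by apply/set0Pn; exists y; rewrite !inE eqxx.
Qed.

(** A shift that changes [F] lowers this sum, so shifting terminates. *)
Definition weight F := \sum_(X in F) \sum_(i in X) val i.

Lemma weight_push y x X : y < x -> push y x X != X ->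
  \sum_(i in push y x X) val i < \sum_(i in X) val i.
Proof.
move=> yx; rewrite /push; case: ifP => [/andP[xX yX] _|]; last by rewrite eqxx.
by rewrite big_setU1 ?inE ?negb_and ?yX ?orbT //= (big_setD1 x xX) /= ltn_add2r.
Qed.

Lemma weight_shift y x F : y < x -> weight (shift y x F) <= weight F ?= iff
  [forall X in F, push y x X \in F].
Proof.
move=> yx; rewrite /weight /shift big_imset /=; last exact: push_in_inj.
apply: leqif_sum => X XF; rewrite /push_in; case: ifP => pX; first exact/leqif_refl.
apply/leqifP; apply: weight_push => //.
by apply: contraFneq pX => ->.
Qed.

(** Both families have to be shifted simultaneously for the pair to remain
    cross-intersecting. *)
Lemma shift_ind (Q : {set {set 'I_n}} -> {set {set 'I_n}} -> Prop) :
  (forall A B, shifted A -> shifted B -> cross_intersecting A B -> Q A B) ->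
  (forall y x A B, cross_intersecting A B ->
     Q (shift y x A) (shift y x B) -> Q A B) ->
  forall A B, cross_intersecting A B -> Q A B.
Proof.
move=> Qs Qi A B; have [m] := ubnP (weight A + weight B).
elim: m A B => // m IH A B wm AB.
have [/forallP h|] := boolP [forall p : 'I_n * 'I_n, (p.1 < p.2) ==>
   ([forall X in A, push p.1 p.2 X \in A] && [forall X in B, push p.1 p.2 X \in B])].
  apply: Qs => // x y yx X XF; have /implyP/(_ yx)/andP[hA hB] := h (y, x).
  - by have /forallP/(_ X)/implyP/(_ XF) := hA.
  - by have /forallP/(_ X)/implyP/(_ XF) := hB.
case/forallPn => -[y x] /=; rewrite negb_imply => /andP[yx hAB].
apply: (Qi y x) => //; apply: IH; last exact: shift_cross.
rewrite -ltnS; apply: leq_trans wm; rewrite ltnS.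
have [lA eA] := weight_shift A yx; have [lB eB] := weight_shift B yx.
move: hAB; rewrite -eA -eB negb_and; lia.
Qed.

End Shift.

(** * Prefixes of members of shifted families *)

Section Prefix.
Variable n : nat.
Implicit Types (x y : 'I_n) (X Y : {set 'I_n}) (F A B : {set {set 'I_n}}).

Definition prefix_count X t := #|X :&: [set i : 'I_n | i < t]|.

Lemma prefix_count0 X : prefix_count X 0 = 0.
Proof. by apply: eq_card0 => i; rewrite !inE andbF. Qed.

Lemma prefix_countS X x : prefix_count X x.+1 = (x \in X) + prefix_count X x.
Proof.
rewrite /prefix_count (cardsD1 x) !inE ltnSn andbT; congr (_ + #|pred_of_set _|).
apply/setP=> i; rewrite !inE ltnS leq_eqVlt.
by have [->|ne] := eqVneq i x; [rewrite ltnn andbF | rewrite (negbTE (ne : val i != val x))].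
Qed.

Lemma prefix_count_mono X t t' : t <= t' -> prefix_count X t <= prefix_count X t'.
Proof.
move=> tt; apply: subset_leq_card; apply/setIS/subsetP=> i.
by rewrite !inE => /leq_trans; apply.
Qed.

Lemma prefix_count_n X t : n <= t -> prefix_count X t = prefix_count X n.
Proof.
move=> nt; congr #|pred_of_set _|; apply/setP=> i; rewrite !inE ltn_ord.
by rewrite (leq_trans (ltn_ord i) nt).
Qed.

Lemma prefix_count_gain X Y t x : t <= x -> (forall z : 'I_n, t <= z < x -> z \in X :|: Y) ->
  prefix_count X t + prefix_count Y t + (x - t) <= prefix_count X x + prefix_count Y x.
Proof.
move=> tx; have [d] := ubnP (x - t); elim: d x tx => // d IH x tx dx XY.
move: tx; rewrite leq_eqVlt => /predU1P[->|tx]; first by rewrite subnn addn0.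
have px : x.-1 < n by have := ltn_ord x; lia.
have [z xz] : exists z : 'I_n, x = z.+1 :> nat by exists (Ordinal px) => /=; lia.
have tz : t <= z by lia.
have zXY : z \in X :|: Y by apply: XY; lia.
have IHz : prefix_count X t + prefix_count Y t + (z - t) <= prefix_count X z + prefix_count Y z.
  by apply: IH => // [|w hw]; [lia | apply: XY; lia].
by rewrite xz !prefix_countS; move: zXY; rewrite inE; do 2 case: (z \in _) => //=; lia.
Qed.

Lemma prefix_count_push y x Y t : y < x -> x \in Y -> y \notin Y ->
  prefix_count (push y x Y) t = prefix_count Y t + (y < t <= x).
Proof.
move=> yx xY yY; rewrite /prefix_count /push xY yY /=.
have [ty|yt] := leqP t y => /=.
  rewrite addn0; congr #|pred_of_set _|; apply/setP=> i; rewrite !inE.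
  by case: eqP => [->|_]; case: eqP => [->|_] //=; rewrite ?(negbTE yY) ?xY //; lia.
rewrite setIUl (setIidPl _) ?sub1set ?inE // cardsU1 !inE (negbTE yY) andbF /=.
have [xt|tx] := leqP t x.
  rewrite addnC; congr (#|pred_of_set _| + 1); apply/setP=> i; rewrite !inE.
  by case: eqP => [->|_] //=; rewrite xY; lia.
rewrite addn0 [RHS](cardsD1 x) !inE xY tx /=; congr (_ + #|pred_of_set _|).
by rewrite setIDAC.
Qed.

(** Frankl's observation.  Call a prefix crowded if it has fewer elements than
    [X] and [Y] have in it together.  If none is, let [x] be a common element of
    [X] and [Y]; some element below [x] is in neither of them, and [y] denotes the
    last one.  Moving [x] down to [y] in [Y] creates no crowded prefix, since
    everything between [y] and [x] is covered and [x] was counted twice, and it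
    decreases the intersection.  But [X] and [Y] never become disjoint. *)
Lemma shifted_cross_prefix A B : shifted B -> cross_intersecting A B ->
  forall X Y, X \in A -> Y \in B -> exists2 t, t <= n & t < prefix_count X t + prefix_count Y t.
Proof.
move=> sB AB X Y XA; have [c] := ubnP #|X :&: Y|.
elim: c Y => // c IH Y cXY YB.
have /set0Pn[x xXY] := AB _ _ XA YB.
have [xX xY] : x \in X /\ x \in Y by move: xXY; rewrite inE => /andP[].
(* a covered interval from t to x, followed by x itself, which counts twice *)
have done_at t : t <= x -> (forall z : 'I_n, t <= z < x -> z \in X :|: Y) ->
    t <= prefix_count X t + prefix_count Y t -> x.+1 < prefix_count X x.+1 + prefix_count Y x.+1.
  move=> tx XY ht; have := prefix_count_gain tx XY; rewrite !prefix_countS xX xY; lia.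
pose free := [pred y : 'I_n | (y < x) && (y \notin X :|: Y)].
have [y0 y0free|nofree] := pickP free; last first.
  exists x.+1; first exact: ltn_ord.
  apply: (done_at 0) => // z /andP[_ zx]; have /= := nofree z; rewrite zx /=.
  by move/negbFE.
case: (arg_maxnP val y0free) => y /andP[yx]; rewrite !inE negb_or => /andP[yX yY] ymax.
have between (z : 'I_n) : y < z < x -> z \in X :|: Y.
  move=> /andP[yz zx]; apply: contraTT yz => zXY; rewrite -leqNgt.
  by apply: ymax; rewrite /free /= zx.
have [t tn] : exists2 t, t <= n & t < prefix_count X t + prefix_count (push y x Y) t.
  apply: IH; last exact: sB.
  rewrite -ltnS; apply: leq_trans cXY; rewrite ltnS (cardsD1 x (X :&: Y)) xXY add1n ltnS.
  apply: subset_leq_card; apply/subsetP=> z; rewrite /push xY yY !inE.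
  case/andP=> zX /orP[/eqP zy|/andP[-> ->]]; last by rewrite zX.
  by rewrite -zy zX in yX.
rewrite prefix_count_push //; case: andP => [[yt tx]|_]; last by rewrite addn0; exists t.
move=> ht; exists x.+1; first exact: ltn_ord.
apply: (done_at t) => //; last by lia.
by move=> z /andP[tz zx]; apply: between; rewrite zx (leq_trans yt).
Qed.

(** A set with more than half of a prefix of even length has more than half of
    the next prefix too, so only odd lengths are considered. *)
Definition tall m X := m < prefix_count X m.*2.+1.

Lemma tall_of_prefix_count t X : t./2 < prefix_count X t -> tall t./2 X.
Proof. by move=> h; apply: leq_trans h _; apply: prefix_count_mono; lia. Qed.

Lemma card_prefix t : #|[set i : 'I_n | i < t]| <= t.
Proof.
have -> : #|[set i : 'I_n | i < t]| = prefix_count setT t by rewrite /prefix_count setTI.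
elim: t => [|t IH]; first by rewrite prefix_count0.
have [tn|nt] := ltnP t n; last by rewrite prefix_count_n ?leqW // -(@prefix_count_n _ t) ?(leqW IH).
by have := prefix_countS setT (Ordinal tn); rewrite /= => ->; rewrite inE ltnS.
Qed.

Lemma card_tall s k m : s * k <= n ->
  s ^ m.+1 * #|[set X : {set 'I_n} | (#|X| == k) && tall m X]| <= 2 ^ m.*2.+1 * 'C(n, k).
Proof.
move=> skn; have := @card_tail _ [set i : 'I_n | i < m.*2.+1] s k m.+1.
rewrite card_ord => /(_ skn) h; apply: leq_trans h _.
by rewrite leq_mul2r leq_exp2l // card_prefix orbT.
Qed.

Definition tall_beyond j X := [exists m : 'I_n, (j <= m) && tall m X].

Lemma sum_geometric_leq (c : nat -> nat) K M :
  (forall m, c m * 2 ^ m <= K) -> (\sum_(m < M) c m) <= 2 * K.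
Proof.
move=> cK; have h : 2 ^ M * (\sum_(m < M) c m) + 2 * K <= 2 ^ M * (2 * K).
  elim: M => [|M IH]; first by rewrite big_ord0 expn0 !mul1n.
  rewrite big_ord_recr /= expnS; move: (cK M) IH.
  by move: (2 ^ M) (c M) (\sum_(m < M) c m) => e d S; lia.
have : 2 ^ M * (\sum_(m < M) c m) <= 2 ^ M * (2 * K) by apply: leq_trans h; exact: leq_addr.
by rewrite leq_pmul2l // expn_gt0.
Qed.

(** By [card_tall] the [m]-th condition has density at most
    [2 * 4 ^ m / s ^ m.+1], a geometric series whose first term, for [m = 1], is
    of order [s ^- 2]. *)
Lemma card_tall_beyond1 s k : 8 <= s -> s * k <= n ->
  s ^ 2 * #|[set X : {set 'I_n} | (#|X| == k) && tall_beyond 1 X]| <= 16 * 'C(n, k).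
Proof.
move=> s8 skn.
pose c m := #|[set X : {set 'I_n} | (#|X| == k) && tall m.+1 X]|.
have hc m : s ^ 2 * c m * 2 ^ m <= 8 * 'C(n, k).
  have := card_tall m.+1 skn; rewrite -/(c m) => h.
  rewrite -(leq_pmul2l (_ : 0 < 4 ^ m)) ?expn_gt0 //.
  have -> : 4 ^ m * (s ^ 2 * c m * 2 ^ m) = s ^ 2 * 8 ^ m * c m.
    by rewrite -[8]/(4 * 2) expnMn; lia.
  apply: (@leq_trans (s ^ m.+2 * c m)).
    rewrite leq_mul2r; apply/orP; right; rewrite -[m.+2]addn2 expnD mulnC leq_mul2r.
    by apply/orP; right; case: (m) => // m'; rewrite leq_exp2r.
  apply: leq_trans h _; rewrite doubleS -addnn.
  by rewrite !expnS expnD -[4]/(2 * 2) expnMn; lia.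
have : s ^ 2 * \sum_(m < n) c m <= 2 * (8 * 'C(n, k)).
  by rewrite big_distrr /=; exact: (@sum_geometric_leq (fun m => s ^ 2 * c m) _ n hc).
rewrite mulnA; apply: leq_trans; rewrite leq_mul2l; apply/orP; right.
pose S m := [set X : {set 'I_n} | (#|X| == k) && tall m.+1 X].
have sub : [set X : {set 'I_n} | (#|X| == k) && tall_beyond 1 X] \subset
   \bigcup_(m in [set: 'I_n]) S m.
  apply/subsetP=> X; rewrite inE => /andP[kX /existsP[m /andP[m1 tX]]].
  have mn : m.-1 < n by have := ltn_ord m; lia.
  by apply/bigcupP; exists (Ordinal mn); rewrite !inE //= prednK // kX.
apply: leq_trans (subset_leq_card sub) _.
apply: leq_trans (card_bigcup_leq _ _) _.
by rewrite (eq_bigl xpredT) // => m; rewrite inE.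
Qed.

Lemma card_tall_beyond0 s k : 8 <= s -> s * k <= n ->
  s * #|[set X : {set 'I_n} | (#|X| == k) && tall_beyond 0 X]| <= 4 * 'C(n, k).
Proof.
move=> s8 skn; have h1 := card_tall_beyond1 s8 skn; have h0 := card_tall 0 skn.
set b := #|_| in h1; set c := #|_| in h0; set a := #|_|.
have : a <= c + b.
  apply: leq_trans (leq_card_setU _ _); apply: subset_leq_card; apply/subsetP=> X.
  rewrite !inE => /andP[-> /existsP[m /andP[_ tX]]] /=.
  by case: (posnP m) => m0; [rewrite -m0 tX | apply/orP; right; apply/existsP; exists m; rewrite m0].
have h2 : 8 * (s * b) <= s ^ 2 * b by rewrite -mulnn -mulnA leq_mul2r s8 orbT.
move=> ha; apply: (@leq_trans (s * c + s * b)); first by rewrite -mulnDr leq_mul2l ha orbT.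
move: h0; rewrite expn1 (_ : 2 ^ 0.*2.+1 = 2) //; lia.
Qed.

(** If [X] takes at most half of each prefix then [Y] takes more than half of
    the crowded one; its length is not [1], because [X] misses the first
    element and [Y] alone cannot crowd it. *)
Lemma shifted_cross_tall A B : shifted B -> cross_intersecting A B ->
  forall X Y, X \in A -> Y \in B -> ~~ tall_beyond 0 X -> tall_beyond 1 Y.
Proof.
move=> sB AB X Y XA YB nX.
have [t tn ht] := shifted_cross_prefix sB AB XA YB.
have t0 : 0 < t by case: (t) ht => //; rewrite !prefix_count0.
have tn2 : t./2 < n by lia.
have lX : prefix_count X t <= t./2.
  rewrite leqNgt; apply: contra nX => /tall_of_prefix_count tX.
  by apply/existsP; exists (Ordinal tn2).
have lY : t./2 < prefix_count Y t by lia.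
apply/existsP; exists (Ordinal tn2); rewrite /= tall_of_prefix_count // andbT.
rewrite lt0n; apply/negP => /eqP t2.
have t1 : t = 1 by lia.
have : prefix_count Y t <= t by apply: leq_trans (card_prefix t); rewrite /prefix_count subset_leq_card ?subsetIr.
lia.
Qed.

(** Shifting preserves both sizes.  After it, either each member of [A] takes
    more than half of some prefix, or a single member which does not forces all
    members of [B] to do so beyond the first element. *)
Lemma cross_density s a b A B : 8 <= s -> s * a <= n -> s * b <= n ->
  cross_intersecting A B -> uniform a A -> uniform b B ->
  s * #|A| <= 4 * 'C(n, a) \/ s ^ 2 * #|B| <= 16 * 'C(n, b).
Proof.
move=> s8 sa sb AB; elim/shift_ind: A B / AB; last first.
  move=> y x A B _; rewrite !card_shift => IH uA uB.
  by apply: IH; apply: shift_uniform.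
move=> A B _ sB AB uA uB.
have [/forallP hA|/forallPn[X]] := boolP [forall X in A, tall_beyond 0 X].
  left; apply: leq_trans (card_tall_beyond0 s8 sa); rewrite leq_mul2l subset_leq_card ?orbT //.
  apply/subsetP=> X XA; rewrite inE uA ?eqxx //=.
  by have /implyP/(_ XA) := hA X.
rewrite negb_imply => /andP[XA nX].
right; apply: leq_trans (card_tall_beyond1 s8 sb); rewrite leq_mul2l subset_leq_card ?orbT //.
apply/subsetP=> Y YB; rewrite inE uB ?eqxx //=.
exact: (shifted_cross_tall sB AB XA YB nX).
Qed.

End Prefix.

(** * Existence of a centre *)

Section Diversity.
Variable n : nat.
Implicit Types (i x y : 'I_n) (X Y : {set 'I_n}) (F : {set {set 'I_n}}).

Lemma bin_pred_scale s k : 2 <= s -> s * k.+1 <= n -> s * 'C(n, k) <= 2 * 'C(n, k.+1).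
Proof.
move=> s2 skn; rewrite -(leq_pmul2l (ltn0Sn k)) [k.+1 * (2 * _)]mulnCA.
rewrite mul_bin_left !mulnA leq_mul2r; apply/orP; right.
by case: s s2 skn => [|[|s]] // _; rewrite mulSn; nia.
Qed.

(** The link of [i] and the members avoiding [i] are cross-intersecting, and the
    link lives one level below, where the layer is smaller by a factor [s / 2]. *)
Lemma star_or_avoid s k F i : 8 <= s -> 0 < k -> s * k <= n ->
  uniform k F -> cross_intersecting F F ->
  s ^ 2 * #|[set X in F | i \in X]| <= 8 * 'C(n, k) \/
  s ^ 2 * #|[set X in F | i \notin X]| <= 16 * 'C(n, k).
Proof.
case: k => // k s8 _ skn Fk FF.
pose A := [set X :\ i | X in [set X in F | i \in X]].
have cA : #|A| = #|[set X in F | i \in X]|.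
  apply: card_in_imset => X Y; rewrite !inE => /andP[_ iX] /andP[_ iY] e.
  by rewrite -(setD1K iX) -(setD1K iY) e.
have Ak : uniform k A.
  move=> Z /imsetP[X]; rewrite inE => /andP[XF iX] ->.
  by have := cardsD1 i X; rewrite iX (Fk _ XF) => -[].
have AB : cross_intersecting A [set X in F | i \notin X].
  move=> Z Y /imsetP[X]; rewrite inE => /andP[XF iX] ->; rewrite inE => /andP[YF iY].
  have /set0Pn[z] := FF _ _ XF YF; rewrite inE => /andP[zX zY].
  apply/set0Pn; exists z; rewrite !inE zX zY !andbT.
  by apply: contraNneq iY => <-.
have skn' : s * k <= n by apply: leq_trans skn; rewrite leq_mul2l leqnSn orbT.
have Bk : uniform k.+1 [set X in F | i \notin X].
  by move=> X; rewrite inE => /andP[/Fk].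
have [h|h] := cross_density s8 skn' skn AB Ak Bk; [left|by right].
have := bin_pred_scale (ltnW (ltnW (ltnW (ltnW (ltnW (ltnW s8)))))) skn.
rewrite -cA -mulnn -mulnA => hb.
apply: (@leq_trans (s * (4 * 'C(n, k)))); first by rewrite leq_mul2l h orbT.
lia.
Qed.

(** The prefix lemma applied to a set and itself. *)
Lemma shifted_avoid0 s k F (n0 : 0 < n) : 8 <= s -> s * k <= n ->
  uniform k F -> cross_intersecting F F -> shifted F ->
  s ^ 2 * #|[set X in F | Ordinal n0 \notin X]| <= 16 * 'C(n, k).
Proof.
move=> s8 skn Fk FF sF.
apply: leq_trans (card_tall_beyond1 s8 skn); rewrite leq_mul2l; apply/orP; right.
apply/subset_leq_card/subsetP=> X; rewrite !inE => /andP[XF oX].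
rewrite Fk ?eqxx //=.
have [|nX] := boolP (tall_beyond 0 X); last exact: (shifted_cross_tall sF FF XF XF).
case/existsP=> m /andP[_ tX]; apply/existsP; exists m; rewrite tX andbT.
rewrite lt0n; apply: contraNneq oX => m0; move: tX.
rewrite /tall m0 /= => h.
by have := prefix_countS X (Ordinal n0); rewrite /= prefix_count0 addn0; case: (_ \in X) => //= e; rewrite e in h.
Qed.

(** Every intersecting family has a centre, an element avoided by
    [O(N / s ^ 2)] members only, where [N = 'C(n, k)].  Going back
    along one shift, suppose that [shift y x F] has the centre [i].  If [F] has no
    centre, then [x] and [i] have small degree in [F] by [star_or_avoid], and a
    member of [F] containing neither is untouched by the shift, hence is
    counted among the members of [shift y x F] avoiding [i].  So [F] is small as
    a whole; then so are all the earlier families, and any element is a centre. *)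
Theorem exists_centre s k F : 8 <= s -> 0 < k -> s * k <= n ->
  uniform k F -> cross_intersecting F F ->
  exists i, s ^ 2 * #|[set X in F | i \notin X]| <= 32 * 'C(n, k).
Proof.
move=> s8 k0 skn Fk FF.
have n0 : 0 < n by nia.
suff : s ^ 2 * #|F| <= 32 * 'C(n, k) \/
    exists i, s ^ 2 * #|[set X in F | i \notin X]| <= 16 * 'C(n, k).
  case=> [h|[i h]]; last by exists i; lia.
  exists (Ordinal n0); apply: leq_trans h; rewrite leq_mul2l; apply/orP; right.
  by apply/subset_leq_card/subsetP=> X; rewrite inE => /andP[].
pose Q A B := A = B -> uniform k A -> s ^ 2 * #|A| <= 32 * 'C(n, k) \/
    exists i, s ^ 2 * #|[set X in A | i \notin X]| <= 16 * 'C(n, k).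
apply: (@shift_ind n Q _ _ F F FF (erefl F) Fk) => {F Fk FF}.
  move=> F G _ sF FF eFG Fk; rewrite -eFG in sF FF; right; exists (Ordinal n0).
  exact: shifted_avoid0.
move=> y x F G FF IH eFG Fk; rewrite -eFG in FF IH.
have [|[i hi]] := IH (erefl _) (shift_uniform Fk); first by rewrite card_shift; left.
have [hx|hx] := star_or_avoid x s8 k0 skn Fk FF; last by right; exists x.
have [h'|h'] := star_or_avoid i s8 k0 skn Fk FF; last by right; exists i.
(* 32 = 8 + 8 + 16 *)
left.
have : #|F| <= #|[set X in F | x \in X]| + #|[set X in F | i \in X]|
     + #|[set X in shift y x F | i \notin X]|.
  apply: leq_trans (leq_trans (leq_card_setU _ _) (leq_add (leq_card_setU _ _) (leqnn _))).
  apply/subset_leq_card/subsetP=> X XF; rewrite !inE XF /=.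
  have [|xX] //= := boolP (x \in X); have [|iX] //= := boolP (i \in X).
  by rewrite mem_shift_avoid.
rewrite -(leq_pmul2l (_ : 0 < s ^ 2)) ?expn_gt0 ?(leq_trans _ s8) // => h.
apply: leq_trans h _; rewrite !mulnDr.
by apply: leq_trans (leq_add (leq_add hx h') hi) _; rewrite -!mulnDl.
Qed.
End Diversity.

(** * Density of cross-intersecting families *)

Section RandomPermutation.
Variables (T : finType) (V : {set T}).
Implicit Types (A B X Y : {set T}) (F : {set {set T}}) (sigma tau : {perm T}).

Definition layer k := [set A : {set T} | (A \subset V) && (#|A| == k)].

Lemma card_layer k : #|layer k| = 'C(#|V|, k).
Proof. exact: cards_draws. Qed.

Lemma imset_permM sigma tau A : (sigma * tau)%g @: A = tau @: (sigma @: A).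
Proof. by rewrite -imset_comp; apply: eq_imset => z; rewrite /= permM. Qed.

Lemma perm_transport X Y : X \subset V -> Y \subset V -> #|X| = #|Y| ->
  exists2 tau, perm_on V tau & tau @: X = Y.
Proof.
have [c] := ubnP #|X :\: Y|; elim: c X => // c IH X cXY XV YV eXY.
have eD : #|X :\: Y| = #|Y :\: X| by rewrite !cardsD eXY setIC.
have [XY0|/set0Pn[x xXY]] := eqVneq (X :\: Y) set0.
  exists 1%g; first exact: perm_on1.
  have XY : X \subset Y by rewrite -setD_eq0 XY0.
  rewrite (eq_imset _ (@perm1 T)) imset_id.
  by apply/eqP; rewrite eqEcard XY eXY leqnn.
have /set0Pn[y yYX] : Y :\: X != set0.
  by rewrite -card_gt0 -eD card_gt0; apply/set0Pn; exists x.
move: (xXY) (yYX); rewrite !inE => /andP[xY xX] /andP[yX yY].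
have xy : x != y by apply: contraNneq yX => <-.
have eX' : tperm x y @: X = y |: (X :\ x).
  apply/setP=> z; rewrite -{1}(tpermK x y z) mem_imset; last exact: perm_inj.
  rewrite !inE; case: tpermP => [->|->|/eqP zx /eqP zy].
  - by rewrite (negbTE yX) eqxx (negbTE xy).
  - by rewrite xX eqxx.
  by rewrite zx (negbTE zy).
have X'V : y |: (X :\ x) \subset V.
  by rewrite subUset sub1set (subsetP YV) // (subset_trans (subsetDl _ _) XV).
have cX' : #|y |: (X :\ x)| = #|Y|.
  by rewrite -eXY cardsU1 !inE negb_and yX orbT (cardsD1 x X) xX.
have [|tau tauV tauX] := IH (y |: (X :\ x)) _ X'V YV cX'.
  rewrite -ltnS; apply: leq_trans cXY; rewrite ltnS [X in _ < X](cardsD1 x) xXY add1n ltnS.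
  apply/subset_leq_card/subsetP=> z; rewrite !inE.
  by case/andP=> zY /orP[/eqP zy|/andP[-> ->]]; [rewrite zy yY in zY | rewrite zY].
exists (tperm x y * tau)%g.
  apply: perm_onM => //; apply/subsetP=> z; rewrite inE; case: tpermP => [->|->|_ _].
  - by rewrite (subsetP XV).
  - by rewrite (subsetP YV).
  by rewrite eqxx.
by rewrite imset_permM eX'.
Qed.

Definition perms_on := [set sigma | perm_on V sigma].

Lemma layer_perm sigma k A : perm_on V sigma -> A \in layer k -> sigma @: A \in layer k.
Proof.
move=> sV; rewrite !inE => /andP[AV /eqP kA]; rewrite card_imset ?kA ?eqxx ?andbT; last exact: perm_inj.
by apply/subsetP=> _ /imsetP[z zA ->]; rewrite perm_closed // (subsetP AV).
Qed.

(** A random permutation of [V] maps [B] to a uniformly distributed [k]-set. *)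
Lemma card_perms_into (k : nat) B F : B \in layer k -> F \subset layer k ->
  #|[set sigma in perms_on | sigma @: B \in F]| * 'C(#|V|, k) = #|F| * #|perms_on|.
Proof.
move=> Bk Fk; pose c X := #|[set sigma in perms_on | sigma @: B == X]|.
have cB X : X \in layer k -> c X = c B.
  move: Bk; rewrite !inE => /andP[BV /eqP kB] /andP[XV /eqP kX].
  have [tau tauV tauX] := perm_transport XV BV (etrans kX (esym kB)).
  rewrite /c -(card_imset _ (@mulIg _ tau)); congr #|pred_of_set _|.
  apply/setP=> sigma; apply/imsetP/idP => [[rho]|].
    rewrite !inE => /andP[rhoV /eqP rhoB] ->; rewrite perm_onM //=.
    by rewrite imset_permM rhoB tauX.
  rewrite !inE => /andP[sV /eqP sB]; exists (sigma * tau^-1)%g; last by rewrite mulgKV.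
  rewrite !inE perm_onM ?perm_onV //= imset_permM sB -tauX -imset_comp.
  by rewrite (eq_imset (g := id)) ?imset_id // => z /=; rewrite permK.
have cF (E : {set {set T}}) : E \subset layer k -> #|[set sigma in perms_on | sigma @: B \in E]| = #|E| * c B.
  move=> Ek; rewrite -[LHS]sum1_card (partition_big (fun sigma => sigma @: B) (mem E)) /=; last first.
    by move=> sigma; rewrite !inE => /andP[].
  rewrite -sum_nat_const; apply: eq_bigr => X XE; rewrite -(cB X) ?(subsetP Ek) //.
  rewrite sum1_card; apply: eq_card => sigma; rewrite !inE unfold_in /= !inE.
  by case: eqP => [->|]; rewrite ?XE ?andbF ?andbT.
have : #|[set sigma in perms_on | sigma @: B \in layer k]| = #|perms_on|.
  apply: eq_card => sigma; rewrite !inE; case: (boolP (perm_on V sigma)) => //= sV.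
  by have := layer_perm sV Bk; rewrite inE.
rewrite !cF // card_layer => <-; lia.
Qed.

(** Fix [r] sets of size [a] and a [b]-set [Y] of [V] disjoint from all of them.
    Under a random permutation of [V], the image of [Y] is in [B] with
    probability equal to the density of [B], and then the images of the [r] sets are
    outside [D].  Averaging over all choices of the [r] sets, which become
    independent, bounds the density of [B] by the [r]-th power of the density of
    the complement of [D]. *)
Lemma cross_power_bound r a b (D B : {set {set T}}) : r * a + b <= #|V| ->
  D \subset layer a -> B \subset layer b -> cross_intersecting D B ->
  #|B| * 'C(#|V|, a) ^ r <= 'C(#|V|, b) * ('C(#|V|, a) - #|D|) ^ r.
Proof.
move=> rab Da Bb DB; pose H := layer a :\: D.
have cH : #|H| = 'C(#|V|, a) - #|D| by rewrite cardsD (setIidPr Da) card_layer.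
rewrite -cH.
have HP (A X : {set T}) : A \in layer a -> X \in B -> [disjoint A & X] -> A \in H.
  move=> Aa XB /disjoint_setI0 AX; rewrite inE Aa andbT.
  by apply: contra_eqN AX => AD; apply: DB.
(* the event that all r sets are sent outside D *)
pose R sigma (t : {ffun 'I_r -> {set T}}) := [forall i, sigma @: t i \in H].
pose L := [set t : {ffun 'I_r -> {set T}} | t \in ffun_on (mem (layer a))].
have cL : #|L| = 'C(#|V|, a) ^ r by rewrite cardsE card_ffun_on card_layer card_ord.
have perms_gt0 : 0 < #|perms_on| by apply/card_gt0P; exists 1%g; rewrite inE perm_on1.
have low t : t \in L ->
    #|B| * #|perms_on| <= 'C(#|V|, b) * #|[set sigma in perms_on | R sigma t]|.
  rewrite inE => /ffun_onP tL; pose U := \bigcup_(i in [set: 'I_r]) t i.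
  have cU : #|U| <= r * a.
    apply: leq_trans (card_bigcup_leq _ _) _.
    rewrite (eq_bigr (fun=> a)) ?sum_nat_const ?cardsT ?card_ord // => i _.
    by have := tL i; rewrite inE => /andP[_ /eqP].
  have : 0 < #|[set Y : {set T} | Y \subset V :\: U & #|Y| == b]|.
    rewrite cards_draws bin_gt0 cardsD.
    have := subset_leq_card (subsetIr V U); lia.
  case/card_gt0P => Y; rewrite inE subsetD => /andP[/andP[YV YU] kY].
  have Yb : Y \in layer b by rewrite inE YV.
  rewrite -(card_perms_into Yb Bb) mulnC leq_mul2l; apply/orP; right.
  apply/subset_leq_card/subsetP=> sigma; rewrite !inE => /andP[sV sY]; rewrite sV /=.
  apply/forallP=> i; apply: (HP _ (sigma @: Y)) => //; first exact: layer_perm.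
  rewrite -setI_eq0 -imsetI; last by move=> ? ? _ _; apply: perm_inj.
  rewrite (_ : t i :&: Y = set0) ?imset0 //.
  apply/eqP; rewrite setI_eq0 disjoint_sym; apply: disjointWr YU.
  by apply: bigcup_sup; rewrite inE.
have up sigma : sigma \in perms_on -> #|[set t in L | R sigma t]| <= #|H| ^ r.
  rewrite inE => sV; rewrite -[r in _ ^ r]card_ord -card_ffun_on.
  pose f (t : {ffun 'I_r -> {set T}}) := [ffun i => sigma @: t i].
  rewrite -(card_imset (f := f)).
    apply/subset_leq_card/subsetP=> u /imsetP[t]; rewrite !inE => /andP[_ /forallP Rt] ->.
    by apply/ffun_onP=> i; rewrite ffunE.
  move=> t t' /ffunP e; apply/ffunP=> i; have := e i; rewrite !ffunE.
  exact/imset_inj/perm_inj.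
rewrite -(leq_pmul2r perms_gt0) mulnAC -cL.
apply: (@leq_trans (\sum_(t in L) 'C(#|V|, b) * #|[set sigma in perms_on | R sigma t]|)).
  by rewrite mulnC -sum_nat_const; apply: leq_sum.
rewrite -big_distrr -mulnA leq_mul2l /=; apply/orP; right.
have -> : \sum_(t in L) #|[set sigma in perms_on | R sigma t]|
        = \sum_(sigma in perms_on) #|[set t in L | R sigma t]|.
  under eq_bigr do rewrite -sum1_card; under [RHS]eq_bigr do rewrite -sum1_card.
  rewrite (exchange_big_dep (mem perms_on)) /=; last by move=> t s _; rewrite inE => /andP[].
  apply: eq_bigr => s sV; apply: eq_bigl => t; rewrite !inE in sV *.
  by rewrite sV.
by rewrite mulnC -sum_nat_const; apply: leq_sum.
Qed.

End RandomPermutation.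

(** * Double counting, and the link of a pair *)

Lemma sum_degrees_in (T : finType) (L : {set T}) (F : {set {set T}}) :
  \sum_(x in L) #|[set X in F | x \in X]| = \sum_(X in F) #|L :&: X|.
Proof.
under eq_bigr do rewrite -sum1_card; under [RHS]eq_bigr do rewrite -sum1_card.
rewrite (exchange_big_dep (mem F)) /=; last by move=> x X _; rewrite inE => /andP[].
by apply: eq_bigr => X XF; apply: eq_bigl => x; rewrite !inE XF.
Qed.

Lemma sum_codegrees_in (T : finType) (L : {set T}) (F : {set {set T}}) :
  \sum_(x in L) #|[set X in F | x \notin X]| = \sum_(X in F) #|L :\: X|.
Proof.
under eq_bigr do rewrite -sum1_card; under [RHS]eq_bigr do rewrite -sum1_card.
rewrite (exchange_big_dep (mem F)) /=; last by move=> x X _; rewrite inE => /andP[].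
by apply: eq_bigr => X XF; apply: eq_bigl => x; rewrite !inE XF andbC.
Qed.

Lemma subset_of_card (T : finType) (A : {set T}) m : m <= #|A| ->
  exists2 B : {set T}, B \subset A & #|B| = m.
Proof.
move=> mA; have : 0 < #|[set B : {set T} | B \subset A & #|B| == m]|.
  by rewrite cards_draws bin_gt0.
by case/card_gt0P => B; rewrite inE => /andP[BA /eqP kB]; exists B.
Qed.

Section Links.
Variable n : nat.
Implicit Types (i x : 'I_n) (X : {set 'I_n}) (F E : {set {set 'I_n}}).

Definition codegree F i x := #|[set X in F | (i \in X) && (x \in X)]|.

(** [cross_power_bound] for the link of [{i, x}] and the members of [F] avoiding
    both [i] and [x]. *)
Lemma codegree_bound r k F E i x : 2 <= k -> i != x -> r * (k - 2) + k <= n - 2 ->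
  uniform k F -> cross_intersecting F F -> E \subset F ->
  (forall X, X \in E -> (i \notin X) && (x \notin X)) ->
  codegree F i x <= 'C(n - 2, k - 2) /\
  #|E| * 'C(n - 2, k - 2) ^ r
    <= 'C(n - 2, k) * ('C(n - 2, k - 2) - codegree F i x) ^ r.
Proof.
move=> k2 ix hr Fk FF EF Eix.
pose V : {set 'I_n} := ~: [set i; x].
have cV : #|V| = n - 2 by rewrite /V cardsCs setCK cards2 ix card_ord.
pose D := [set X :\: [set i; x] | X in [set X in F | (i \in X) && (x \in X)]].
have sub X : i \in X -> x \in X -> [set i; x] \subset X by rewrite subUset !sub1set => -> ->.
have cD : #|D| = codegree F i x.
  apply: card_in_imset => X Y; rewrite !inE => /and3P[_ iX xX] /and3P[_ iY xY] e.
  by rewrite -(setID X [set i; x]) -(setID Y [set i; x]) e !(setIidPr _) ?sub.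
have Dl : D \subset layer V (k - 2).
  apply/subsetP=> Z /imsetP[X]; rewrite inE => /and3P[XF iX xX] ->.
  rewrite inE cardsD (setIidPr _) ?sub // cards2 ix (Fk _ XF) eqxx andbT.
  by apply/subsetP=> z; rewrite !inE => /andP[].
have El : E \subset layer V k.
  apply/subsetP=> X XE; rewrite inE (Fk _ (subsetP EF _ XE)) eqxx andbT.
  apply/subsetP=> z zX; rewrite !inE; have /andP[iX xX] := Eix _ XE.
  by apply/norP; split; apply: contraTneq zX => ->.
have DE : cross_intersecting D E.
  move=> Z Y /imsetP[X]; rewrite inE => /and3P[XF iX xX] -> YE.
  have /set0Pn[z] := FF _ _ XF (subsetP EF _ YE); rewrite inE => /andP[zX zY].
  have := subsetP El _ YE; rewrite inE => /andP[/subsetP/(_ _ zY) zV _].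
  by apply/set0Pn; exists z; rewrite inE zY andbT inE zX andbT; rewrite inE in zV.
rewrite -cD -cV; split; first by rewrite -card_layer subset_leq_card.
by apply: cross_power_bound; rewrite ?cV.
Qed.

End Links.

(** How the exponent [r = 2] is used: the hypothesis bounds [H] below by
    [P * sqrt (g / Q)], and for small [g] this beats the linear [c * g]. *)
Lemma quadratic_bound g H P Q c : g * P ^ 2 <= Q * H ^ 2 -> c ^ 2 * Q * g < P ^ 2 ->
  c * g <= H.
Proof.
move=> h1 h2; rewrite leqNgt; apply/negP => hH.
have g0 : 0 < g by case: (g) hH => //; rewrite muln0.
suff : P ^ 2 <= c ^ 2 * Q * g by lia.
rewrite -(leq_pmul2l g0); apply: leq_trans h1 _.
have : H ^ 2 <= (c * g) ^ 2 by rewrite leq_exp2r // ltnW.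
rewrite expnMn => h; apply: (@leq_trans (Q * (c ^ 2 * g ^ 2))); first by rewrite leq_mul2l h orbT.
by rewrite -[g ^ 2]mulnn; lia.
Qed.

(** The quotient of the binomials is [n * (n - 1) / (k * (k - 1))], hence close to
    [s ^ 2]; the factor [8] absorbs the replacement of [s.+1] by [s] and of
    [k.-1] by [k]. *)
Lemma bin_pair_lower s n k : 0 < s -> 2 <= k -> n < s.+1 * k ->
  'C(n, k) <= 8 * s ^ 2 * 'C(n - 2, k - 2).
Proof.
case: k => [|[|k]] // s0 _ nsk; rewrite !subSS subn0.
case: n nsk => [|[|n]] nsk; [by rewrite bin_small | by rewrite bin_small | rewrite !subSS subn0].
have h1 : 'C(n.+2, k.+2) <= s.+1 * 'C(n.+1, k.+1).
  rewrite -(leq_pmul2l (ltn0Sn k.+1)) -(mul_bin_diag n.+2 k.+1) /= mulnA leq_mul2r.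
  by apply/orP; right; lia.
have h2 : 'C(n.+1, k.+1) <= 2 * s.+1 * 'C(n, k).
  rewrite -(leq_pmul2l (ltn0Sn k)) -(mul_bin_diag n.+1 k) /= mulnA leq_mul2r.
  by apply/orP; right; nia.
apply: leq_trans h1 _; apply: (@leq_trans (s.+1 * (2 * s.+1 * 'C(n, k)))).
  by rewrite leq_mul2l h2 orbT.
by rewrite !mulnA leq_mul2r; apply/orP; right; nia.
Qed.

(** * Sets with a large trace on [L] *)

Definition large_traces (T : finType) (L : {set T}) k u :=
  [set X : {set T} | (#|X| == k) && (u <= #|X :&: L|)].

(** By [card_tail] the density is at most [2 ^ l / s ^ (2 * w)] with [l = #|L|].
    One factor [s ^ w] beats [4 ^ l], leaving [2 ^- l], and the other is at least
    [s ^ 6]. *)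
Lemma large_traces_rare (T : finType) (L : {set T}) s k w :
  0 < s -> s * k <= #|T| -> 6 <= w -> 4 ^ #|L| <= s ^ w ->
  s ^ 6 * 2 ^ #|L| * #|large_traces L k w.*2| <= 'C(#|T|, k).
Proof.
move=> s0 skn w6 hL; rewrite -(leq_pmul2l (_ : 0 < 2 ^ #|L|)) ?expn_gt0 //.
apply: leq_trans (card_tail L w.*2 skn); rewrite mulnA leq_mul2r; apply/orP; right.
rewrite mulnCA -expnMn -addnn expnD leq_mul //.
by case: s s0 {skn hL} => // -[|s] _; rewrite ?exp1n // leq_exp2l.
Qed.

Lemma trace_sum_bound (T : finType) (L : {set T}) k u (G : {set {set T}}) :
  (forall X, X \in G -> #|X| = k) ->
  \sum_(X in G) #|L :&: X| <= u * #|G| + #|L| * #|large_traces L k u|.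
Proof.
move=> Gk; apply: (@leq_trans (\sum_(X in G) (u + #|L| * (X \in large_traces L k u)))).
  apply: leq_sum => X XG; rewrite inE (Gk _ XG) eqxx /= [L :&: X]setIC.
  case: (leqP u) => h /=; last by rewrite muln0 addn0 ltnW.
  by rewrite muln1 (leq_trans (subset_leq_card (subsetIr X L))) ?leq_addl.
rewrite big_split /= sum_nat_const mulnC leq_add2l -big_distrr /= leq_mul2l.
apply/orP; right.
rewrite (eq_bigr (fun X => if X \in large_traces L k u then 1 else 0)) => [|X _]; last by case: ifP.
rewrite -big_mkcondr /= sum1dep_card.
by apply/subset_leq_card/subsetP=> X; rewrite inE => /andP[].
Qed.

(** * Degrees outside the centre *)

Lemma degree_split n (F : {set {set 'I_n}}) i x :
  degree F x = codegree F i x + #|[set X in [set X in F | i \notin X] | x \in X]|.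
Proof.
rewrite /degree /codegree -(cardsID [set X : {set 'I_n} | i \in X]).
by congr (_ + _); apply: eq_card => X; rewrite !inE; case: (X \in F); case: (i \in X); case: (x \in X).
Qed.

Lemma full_trace_card n k l i (L : {set 'I_n}) (G : {set {set 'I_n}}) :
  #|L| = l -> i \notin L -> (forall X, X \in G -> #|X| = k /\ i \notin X) ->
  #|[set X in G | L \subset X]| <= binz (n - l - 1) (k%:Z - l%:Z)%R.
Proof.
move=> cL iL GP; have [lk|kl] := leqP l k; last first.
  rewrite (_ : [set _ in _ | _] = set0) ?cards0 //.
  apply/setP=> X; rewrite !inE; apply/negP=> /andP[/GP[kX _] /subset_leq_card].
  by rewrite cL kX leqNgt kl.
have -> : (k%:Z - l%:Z)%R = Posz (k - l) by lia.
have cV : #|~: [set i]| = n - 1 by rewrite cardsCs setCK cards1 card_ord.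
have LV : L \subset ~: [set i].
  by apply/subsetP=> z zL; rewrite !inE; apply: contraNneq iL => <-.
have := @card_between _ L (~: [set i]) k LV; rewrite cL cV => /(_ lk) /=.
rewrite (_ : n - l - 1 = n - 1 - l); last by lia.
move=> <-; apply/subset_leq_card/subsetP=> X; rewrite !inE => /andP[XG ->] /=.
have [-> iX] := GP _ XG; rewrite eqxx andbT.
by apply/subsetP=> z zX; rewrite !inE; apply: contraNneq iX => <-.
Qed.

Lemma sqr_leq_exp2 l : 4 <= l -> l ^ 2 <= 2 ^ l.
Proof.
elim: l => // l IH; rewrite leq_eqVlt => /predU1P[<- //|l4].
have h : 4 * l <= l * l by rewrite leq_mul2r -ltnS l4 orbT.
by rewrite [2 ^ _]expnS; have := IH l4; rewrite -!mulnn; move: (2 ^ l) => e; lia.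
Qed.

Lemma scaled_ltn a c g Q N P : a * c * g < N -> Q <= N -> N ^ 2 <= a * P ->
  c * Q * g < P.
Proof.
move=> hN QN NP; have N0 : 0 < N by apply: leq_ltn_trans hN.
have aP : N * (a * c * g) < a * P.
  by apply: leq_trans NP; rewrite -mulnn ltn_pmul2l.
have : Q * (a * c * g) <= N * (a * c * g) by rewrite leq_mul2r QN orbT.
have a0 : 0 < a by case: (a) aP.
by rewrite -(ltn_pmul2l a0); lia.
Qed.


(** * The contradiction around a centre *)

Section AroundCentre.
Variables (n s k l w : nat) (F : {set {set 'I_n}}) (i : 'I_n) (L : {set 'I_n}).
Implicit Types (x : 'I_n) (X : {set 'I_n}) (E : {set {set 'I_n}}).

Local Notation N := 'C(n, k).
Local Notation P := 'C(n - 2, k - 2).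
Local Notation Q := 'C(n - 2, k).

Hypotheses (k2 : 2 <= k) (s64 : 64 <= s) (skn : s * k <= n) (nsk : n < s.+1 * k).
Hypotheses (hs : 2 ^ 12 * s ^ 4 < 2 ^ s).
(* A trace on L counts as large from 2 * w elements on.  The constant turns the
   bound 256 * P on the number of members avoiding i into a contribution of at
   most P / 16 to their average degree on L. *)
Hypotheses (w6 : 6 <= w) (hw : 16 * 512 * w <= l) (hlw : 4 ^ l <= s ^ w).
Hypotheses (Fk : uniform k F) (FF : cross_intersecting F F).
Hypotheses (cL : #|L| = l) (iL : i \notin L).

Let G := [set X in F | i \notin X].

Hypothesis centre : s ^ 2 * #|G| <= 32 * N.
Hypothesis large : forall x, x \in L ->
  P + binz (n - l - 1) (k%:Z - l%:Z)%R < degree F x.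

(** The members containing [L] are set apart: the second binomial of the bound
    pays for them. *)
Let G1 := [set X in G | ~~ (L \subset X)].
(** The number of [k]-sets through [i] and [x] outside [F]. *)
Let missing x := P - codegree F i x.

Let s_gt0 : 0 < s. Proof. exact: leq_trans s64. Qed.
Let l_gt0 : 0 < l. Proof. by apply: leq_trans hw; rewrite muln_gt0 (leq_trans _ w6). Qed.
Let k_le_n : k <= n. Proof. by apply: leq_trans skn; rewrite leq_pmull. Qed.
Let P_gt0 : 0 < P. Proof. by rewrite bin_gt0 leq_sub2r. Qed.
Let NP : N <= 8 * s ^ 2 * P. Proof. exact: bin_pair_lower. Qed.
Let QN : Q <= N. Proof. by apply: leq_bin2l; apply: leq_subr. Qed.

Let G_mem X : X \in G -> #|X| = k /\ i \notin X.
Proof. by rewrite inE => /andP[XF iX]; split=> //; exact: Fk. Qed.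

Let G1_sub : G1 \subset G.
Proof. by apply/subsetP=> X; rewrite inE => /andP[]. Qed.

Let codegree_power r E x : E \subset G -> x \in L -> r * (k - 2) + k <= n - 2 ->
  codegree F i x <= P /\ #|[set X in E | x \notin X]| * P ^ r <= Q * missing x ^ r.
Proof.
move=> EG xL hr; apply: codegree_bound => //.
- by apply: contraNneq iL => ->.
- by apply/subsetP=> X; rewrite inE => /andP[/(subsetP EG)]; rewrite inE => /andP[].
by move=> X; rewrite inE => /andP[/(subsetP EG)]; rewrite inE => /andP[_ ->].
Qed.

Let room2 : 2 * (k - 2) + k <= n - 2.
Proof.
have : 64 * k <= n by apply: leq_trans skn; rewrite leq_mul2r s64 orbT.
lia.
Qed.

Let room_many : (s - 2) * (k - 2) + k <= n - 2.
Proof.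
have [s' es] : exists s', s = s'.+2 by exists (s - 2); lia.
have [k' ek] : exists k', k = k'.+2 by exists (k - 2); lia.
by move: skn; rewrite es ek !subSS !subn0 !mulSn !mulnS; lia.
Qed.

(** The degree of [x] exceeds the number of all [k]-sets through [i] and [x] by
    more than the members containing [L] can account for, so the members in [G1]
    at [x] have to make up for more than the missing sets. *)
Lemma missing_lt x : x \in L -> missing x < #|[set X in G1 | x \in X]|.
Proof.
move=> xL; have [cP _] := codegree_power (subxx G) xL room2.
have := large xL; rewrite (degree_split F i) -/G.
have : #|[set X in G | x \in X]| <=
    #|[set X in G1 | x \in X]| + #|[set X in G | L \subset X]|.
  apply: leq_trans (leq_card_setU _ _); apply/subset_leq_card/subsetP=> X.
  by rewrite !inE => /andP[-> ->]; rewrite /= andbT orNb.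
have := full_trace_card cL iL G_mem; rewrite /missing.
by move: cP; move: (codegree F i x) P (binz _ _) => c p b; do ![move: #|_| => ?]; lia.
Qed.

Let t := #|large_traces L k w.*2|.

Lemma large_traces_count : s ^ 6 * 2 ^ l * t <= N.
Proof.
rewrite -cL -[N](congr1 (fun m => 'C(m, k)) (card_ord n)).
by rewrite large_traces_rare ?card_ord ?cL.
Qed.

Lemma large_traces_leP : 16 * t <= P.
Proof.
have h : s ^ 6 * 2 ^ l * t <= 8 * s ^ 2 * P := leq_trans large_traces_count NP.
have l2 : 2 <= 2 ^ l by rewrite -[X in X <= _](expn1 2) leq_exp2l.
have s4 : 64 <= s ^ 4.
  by rewrite (leq_trans s64) // -[X in X <= _](expn1 s) leq_exp2l // (leq_trans _ s64).
have s2 : 0 < s ^ 2 by rewrite expn_gt0 s_gt0.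
have e6 : s ^ 6 = s ^ 2 * s ^ 4 by rewrite -expnD.
rewrite e6 in h; rewrite -(leq_pmul2l s2).
move: h; move: (s ^ 2) (s ^ 4) (2 ^ l) t P s4 l2 => a b c t' p b64 c2 h.
have bc : 128 <= b * c by rewrite (leq_mul b64 c2).
have : 128 * (a * t') <= b * c * (a * t') by rewrite leq_mul2r bc orbT.
by clear -h; lia.
Qed.

(** A member of [G] meets [L] in less than [2 * w] elements, a small fraction of
    [l], unless its trace is large, and [G] has [O(P)] members. *)
Lemma average_degree_small : 8 * \sum_(x in L) #|[set X in G | x \in X]| <= l * P.
Proof.
have Gcard : #|G| <= 256 * P.
  rewrite -(leq_pmul2l (_ : 0 < s ^ 2)) ?expn_gt0 ?s_gt0 //.
  move: (leq_mul (leqnn 32) NP) centre; move: (s ^ 2) #|G| P N => a g p m h1 h2.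
  by clear -h1 h2; lia.
rewrite sum_degrees_in.
have := @trace_sum_bound _ L k w.*2 G (fun X XG => proj1 (G_mem XG)).
rewrite cL -/t => h; apply: leq_trans (leq_mul (leqnn 8) h) _.
have h1 : w.*2 * #|G| <= w.*2 * (256 * P) by rewrite leq_mul2l Gcard orbT.
have h2 : l * (16 * t) <= l * P by rewrite leq_mul2l large_traces_leP orbT.
have h3 : 16 * 512 * w * P <= l * P by rewrite leq_mul2r hw orbT.
by move: h1 h2 h3; move: #|G| t P => g t' p; clear; lia.
Qed.

Let light := [set x in L | 2 * #|[set X in G | x \in X]| < P].

Lemma many_light : 3 * l <= 4 * #|light|.
Proof.
have heavy : 4 * #|L :\: light| <= l.
  rewrite -(leq_pmul2r P_gt0) -mulnA -sum_nat_const.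
  have : \sum_(x in L :\: light) P <= 2 * \sum_(x in L) #|[set X in G | x \in X]|.
    rewrite [X in _ <= 2 * X](big_setID light) /= mulnDr.
    apply: leq_trans (leq_addl _ _); rewrite big_distrr /=.
    by apply: leq_sum => x; rewrite !inE => /andP[+ xL]; rewrite xL -leqNgt.
  move: average_degree_small; do 2 move: (\sum_(_ in _) _) => ?; move: P => p.
  by clear; lia.
have := cardsID light L; rewrite cL (setIidPr _); last first.
  by apply/subsetP=> x; rewrite inE => /andP[].
by move: heavy; do ![move: #|_| => ?]; clear; lia.
Qed.

(** At a light element less than half of the sets are missing, so that their
    density to the power [s - 2] is exponentially small. *)
Lemma avoid_light_tiny x E : E \subset G -> x \in light ->
  #|[set X in E | x \notin X]| * 2 ^ (s - 2) <= N.
Proof.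
move=> EG; rewrite inE => /andP[xL lightx].
have [_ h] := codegree_power EG xL room_many.
have HP : 2 * missing x <= P.
  have hG1 : #|[set X in G1 | x \in X]| <= #|[set X in G | x \in X]|.
    by apply/subset_leq_card/subsetP=> X; rewrite !inE => /andP[/andP[-> _] ->].
  apply: leq_trans (ltnW lightx); rewrite leq_mul2l /=.
  exact: leq_trans (ltnW (missing_lt xL)) hG1.
apply: leq_trans QN; rewrite -(leq_pmul2r (_ : 0 < P ^ (s - 2))) ?expn_gt0 ?P_gt0 //.
rewrite mulnAC; apply: (@leq_trans (Q * missing x ^ (s - 2) * 2 ^ (s - 2))).
  by rewrite leq_mul2r h orbT.
rewrite -mulnA leq_mul2l -expnMn mulnC; apply/orP; right.
by case: (s - 2) => // m; rewrite leq_exp2r.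
Qed.

Let Gs := [set X in G1 | 2 * #|L :&: X| <= l].
Let Gl := G1 :\: Gs.

Let Gs_sub : Gs \subset G.
Proof. by apply: subset_trans G1_sub; apply/subsetP=> X; rewrite inE => /andP[]. Qed.

Let Gl_sub : Gl \subset G.
Proof. exact: subset_trans (subsetDl _ _) G1_sub. Qed.

(** At least three quarters of [L] are light and a member of [Gs] contains at
    most half of [L], so it avoids at least a quarter of [L] at light elements. *)
Lemma small_traces_tiny : #|Gs| * 2 ^ (s - 2) <= 4 * N.
Proof.
have : \sum_(x in light) #|[set X in Gs | x \notin X]| * 2 ^ (s - 2) <= l * N.
  apply: (@leq_trans (\sum_(x in light) N)).
    by apply: leq_sum => x; apply: avoid_light_tiny.
  rewrite sum_nat_const leq_mul2r -cL subset_leq_card ?orbT //.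
  by apply/subsetP=> x; rewrite inE => /andP[].
rewrite -big_distrl /= sum_codegrees_in => h.
have h2 : l * #|Gs| <= 4 * \sum_(X in Gs) #|light :\: X|.
  rewrite big_distrr /= mulnC -sum_nat_const.
  apply: leq_sum => X; rewrite inE => /andP[_ hX].
  have := cardsID X light; have : #|light :&: X| <= #|L :&: X|.
    by apply/subset_leq_card/setSI/subsetP=> x; rewrite inE => /andP[].
  by move: hX many_light; do ![move: #|_| => ?]; clear; lia.
rewrite -(leq_pmul2l l_gt0); move: h h2.
move: #|_| (2 ^ _) (\sum_(X in _) _) N => g b S m h h2.
have : l * g * b <= 4 * S * b by rewrite leq_mul2r h2 orbT.
by clear -h; lia.
Qed.

(** [r = 2], with the densities expressed in terms of [N] alone. *)
Lemma missing_ge c g x : 64 * s ^ 4 * c ^ 2 * g < N ->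
  g * P ^ 2 <= Q * missing x ^ 2 -> c * g <= missing x.
Proof.
move=> hc hg; apply: quadratic_bound hg _; apply: scaled_ltn hc QN _.
have : N ^ 2 <= (8 * s ^ 2 * P) ^ 2 by rewrite leq_exp2r.
have e4 : s ^ 4 = (s ^ 2) ^ 2 by rewrite -expnM.
by rewrite e4 expnMn [(8 * _) ^ 2]expnMn.
Qed.

Lemma missing_ge_small x : x \in L -> 2 * #|[set X in Gs | x \notin X]| <= missing x.
Proof.
move=> xL; have [_ h] := codegree_power Gs_sub xL room2; apply: missing_ge h.
set g := #|_|.
have gN : g * 2 ^ (s - 2) <= 4 * N.
  apply: leq_trans small_traces_tiny; rewrite leq_mul2r subset_leq_card ?orbT //.
  by apply/subsetP=> X; rewrite inE => /andP[].
have es : 2 ^ s = 4 * 2 ^ (s - 2).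
  by rewrite -[4]/(2 ^ 2) -expnD subnKC // (leq_trans _ s64).
have N_gt0 : 0 < N by rewrite bin_gt0.
rewrite -(ltn_pmul2r (_ : 0 < 2 ^ (s - 2))) ?expn_gt0 // -mulnA.
apply: (@leq_ltn_trans (64 * s ^ 4 * 2 ^ 2 * (4 * N))); first by rewrite leq_mul2l gN orbT.
rewrite mulnA [N * _]mulnC ltn_pmul2r //.
move: hs; rewrite es (_ : 2 ^ 12 = 4 * 1024) //.
by move: (s ^ 4) (2 ^ (s - 2)) => a b; clear; lia.
Qed.

(** The factor [l] is what a member of [Gl], which may avoid a single element
    of [L], needs in the final summation. *)
Lemma missing_ge_large x : x \in L ->
  2 * l * #|[set X in Gl | x \notin X]| <= missing x.
Proof.
move=> xL; have [_ h] := codegree_power Gl_sub xL room2; apply: missing_ge h.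
set g := #|_|.
have wl : 4 * w <= l by apply: leq_trans hw; rewrite leq_mul2r orbT.
have gt : g <= t.
  apply/subset_leq_card/subsetP=> X; rewrite inE => /andP[XGl _].
  move: XGl; rewrite inE => /andP[nGs XG1].
  have [kX _] := G_mem (subsetP G1_sub _ XG1).
  have : l < 2 * #|L :&: X|.
    by rewrite ltnNge; apply: contra nGs => h'; rewrite inE XG1.
  by rewrite inE kX eqxx setIC /=; move: #|_| => c; move: wl; clear; lia.
apply: (@leq_ltn_trans (64 * s ^ 4 * (2 * l) ^ 2 * t)); first by rewrite leq_mul2l gt orbT.
have [->|t0] := posnP t; first by rewrite muln0 bin_gt0.
apply: leq_trans large_traces_count; rewrite ltn_pmul2r // expnMn.
have l2 : l ^ 2 <= 2 ^ l.
  by apply: sqr_leq_exp2; apply: leq_trans wl; rewrite leq_pmulr // (leq_trans _ w6).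
have e6 : s ^ 6 = s ^ 4 * s ^ 2 by rewrite -expnD.
have s2 : 4096 <= s ^ 2 by apply: (@leq_mul 64 64).
have s4 : 0 < s ^ 4 by rewrite expn_gt0 s_gt0.
have e2 : 0 < 2 ^ l by rewrite expn_gt0.
rewrite e6; move: (s ^ 4) (s ^ 2) (2 ^ l) (l ^ 2) s4 s2 e2 l2 => a b e c a0 b4 e0 ce.
rewrite -mulnA mulnCA -[a * b * e]mulnA ltn_pmul2l //.
have : 4096 * e <= b * e by rewrite leq_mul2r b4 orbT.
by rewrite (_ : 2 ^ 2 = 4) //; clear -e0 ce; lia.
Qed.

(** The sum of [missing] over [L] dominates the incidences of [G1] with [L]: a
    member of [Gs] avoids at least as many elements of [L] as it contains, and a
    member of [Gl] contains at most [l] elements and avoids at least one, where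
    it counts [l]-fold. *)
Lemma centre_contradiction : False.
Proof.
have : \sum_(x in L) (missing x).+1 <= \sum_(x in L) #|[set X in G1 | x \in X]|.
  by apply: leq_sum => x xL; apply: missing_lt.
rewrite sum_degrees_in (big_setID Gs) /= -/Gl.
have -> : G1 :&: Gs = Gs by apply/setIidPr/subsetP=> X; rewrite inE => /andP[].
have : \sum_(x in L) (#|[set X in Gs | x \notin X]| + l * #|[set X in Gl | x \notin X]|)
    <= \sum_(x in L) missing x.
  apply: leq_sum => x xL; have := missing_ge_small xL; have := missing_ge_large xL.
  by do ![move: #|_| => ?]; move: (missing x) => m; clear; lia.
rewrite big_split /= -big_distrr /= !sum_codegrees_in.
have h1 : \sum_(X in Gs) #|L :&: X| <= \sum_(X in Gs) #|L :\: X|.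
  apply: leq_sum => X; rewrite inE => /andP[_]; have := cardsID X L; rewrite cL.
  by do ![move: #|_| => ?]; clear; lia.
have h2 : \sum_(X in Gl) #|L :&: X| <= l * \sum_(X in Gl) #|L :\: X|.
  rewrite big_distrr /=; apply: leq_sum => X; rewrite !inE => /andP[_ /andP[_ LX]].
  have : 0 < #|L :\: X| by rewrite card_gt0 setD_eq0.
  have := subset_leq_card (subsetIl L X); rewrite cL => aL d0.
  by rewrite (leq_trans aL) // leq_pmulr.
under [X in _ -> X <= _ -> _]eq_bigr do rewrite -addn1.
rewrite big_split /= sum1_card cL; move: h1 h2 l_gt0.
by do ![move: (\sum_(_ in _) _) => ?]; clear; lia.
Qed.

End AroundCentre.

Lemma few_large_degrees n s k l w (F : {set {set 'I_n}}) (L0 : {set 'I_n}) :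
  2 <= k -> 64 <= s -> s * k <= n -> n < s.+1 * k ->
  2 ^ 12 * s ^ 4 < 2 ^ s -> 6 <= w -> 16 * 512 * w <= l -> 4 ^ l <= s ^ w ->
  uniform k F -> cross_intersecting F F -> l < #|L0| ->
  exists2 x, x \in L0 &
    degree F x <= 'C(n - 2, k - 2) + binz (n - l - 1) (k%:Z - l%:Z)%R.
Proof.
move=> k2 s64 skn nsk hs w6 hw hlw Fk FF lL0.
apply/exists_inP; apply: contraT => /exists_inPn hdeg.
have [i hi] := exists_centre (leq_trans (isT : 8 <= 64) s64) (ltnW k2) skn Fk FF.
have [L LL0 cL] : exists2 L : {set 'I_n}, L \subset L0 :\ i & #|L| = l.
  apply: subset_of_card; move: lL0; rewrite (cardsD1 i L0).
  by case: (i \in L0) => //= /ltnW.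
have iL : i \notin L by apply/negP => /(subsetP LL0); rewrite !inE eqxx.
case: (centre_contradiction k2 s64 skn nsk hs w6 hw hlw Fk FF cL iL hi) => x xL.
by rewrite ltnNge hdeg //; have := subsetP LL0 _ xL; rewrite !inE => /andP[].
Qed.

(** * Choice of the constants *)

(** For [w = l %/ D] one has [l <= 2 * D * w]. *)
Lemma exists_exponent D s l : 0 < D -> 4 ^ (2 * D) <= s -> 6 * D <= l ->
  exists w, [/\ 6 <= w, D * w <= l & 4 ^ l <= s ^ w].
Proof.
move=> D0 hs hl; exists (l %/ D).
have w6 : 6 <= l %/ D by rewrite leq_divRL.
split=> //; first by rewrite mulnC leq_trunc_div.
apply: (@leq_trans ((4 ^ (2 * D)) ^ (l %/ D))); last by rewrite leq_exp2r //; lia.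
rewrite -expnM leq_exp2l //; have := ltn_ceil l D0; nia.
Qed.

(** Since [q < 2 ^ q] for [q = s %/ 8], the left side is at most
    [2 ^ (24 + 4 * q)]. *)
Lemma quartic_lt_exp2 s : 64 <= s -> 2 ^ 12 * s ^ 4 < 2 ^ s.
Proof.
move=> s64; pose q := s %/ 8.
have q6 : 6 <= q by rewrite /q; lia.
have hs : s < 2 ^ (3 + q).
  have : q < 2 ^ q by apply: ltn_expl.
  by rewrite expnD /q; move: (2 ^ _) => e; lia.
apply: (@leq_trans (2 ^ 12 * (2 ^ (3 + q)) ^ 4)).
  by rewrite ltn_pmul2l ?expn_gt0 // ltn_exp2r.
by rewrite -expnM -expnD leq_exp2l // /q; lia.
Qed.

Lemma nth_degree_gt n (F : {set {set 'I_n}}) l M :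
  M < nth_degree F l.+1 -> l < #|[set x | M < degree F x]|.
Proof.
rewrite /nth_degree /= => hM.
set S := degree_seq F in hM.
have lS : l < size S by rewrite ltnNge; apply/negP => h; rewrite nth_default in hM.
have sS : sorted geq S by apply: sort_sorted => a b; apply: leq_total.
have -> : #|[set x | M < degree F x]| = count (fun d => M < d) S.
  rewrite (seq.permP (permEl (perm_sort _ _))) count_map -sum1_count big_enum_cond /=.
  by rewrite sum1dep_card.
have : all (fun d => M < d) (take l.+1 S).
  apply/(all_nthP 0) => j; rewrite size_takel // => jl; rewrite nth_take //.
  apply: leq_trans hM _.
  apply: (sorted_leq_nth (leT := geq)) => //.
  - by move=> a b c ba ac; apply: leq_trans ac ba.
  - by move=> a; apply: leqnn.
  - by rewrite inE (leq_ltn_trans _ lS).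
rewrite all_count size_takel // => /eqP <-.
by rewrite -[X in _ <= count _ X](cat_take_drop l.+1 S) count_cat leq_addr.
Qed.

(** * The bound on the [l + 1]-st degree *)

Unset Implicit Arguments.
Import Order.TTheory GRing.Theory Num.Theory.
Local Open Scope ring_scope.

Theorem theorem1p6 (R : realType) (eps : R) (heps : 0 < eps) :
  exists (C : R) (k0 : nat),
    forall k l n : nat,
      (k0 <= k)%N ->
      eps * k%:R <= l%:R ->
      (l <= k + 1)%N ->
      C * k%:R < n%:R ->
      forall F : {set {set 'I_n}},
        uniform k F ->
        intersecting F ->
        (nth_degree F (l + 1) <=
           binz (n - 2) (k%:Z - 2%:Z) + binz (n - l - 1) (k%:Z - l%:Z))%N.
Proof.
(* D and s0 are kept abstract, to prevent the evaluation of huge numerals *)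
have [D hD] : exists D, D = (16 * 512)%N by exists (16 * 512)%N.
have D0 : (0 < D)%N by rewrite hD.
have [s0 hs0] : exists s0, s0 = (64 + 4 ^ (2 * D))%N by eexists.
exists s0%:R, (Num.bound ((6 * D)%:R / eps)) => k l n hk hl lk hn F Fk Fint.
have l6 : (6 * D <= l)%N.
  rewrite -(ler_nat R); apply: le_trans hl; rewrite mulrC -ler_pdivrMr //.
  apply: (@le_trans _ _ (Num.bound ((6 * D)%:R / eps))%:R); last by rewrite ler_nat.
  by apply/ltW/archi_boundP; rewrite divr_ge0 ?ler0n // ltW.
have k2 : (2 <= k)%N by lia.
have skn : (s0 * k <= n)%N by rewrite -(ler_nat R) natrM ltW.
have hs : (s0 <= n %/ k)%N by rewrite leq_divRL // ltnW.
have [||w [w6 hw hlw]] := @exists_exponent D (n %/ k) l D0 => //; first by lia.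
have s64 : (64 <= n %/ k)%N by lia.
have nsk : (n < (n %/ k).+1 * k)%N by apply: ltn_ceil; lia.
have FF : cross_intersecting F F by move=> X Y XF YF; rewrite -card_gt0; apply: Fint.
have -> : (k%:Z - 2%:Z = Posz (k - 2))%R by lia.
rewrite leqNgt; apply/negP; rewrite addn1 => /nth_degree_gt lL.
rewrite hD in hw.
have [x] := few_large_degrees k2 s64 (leq_trunc_div n k) nsk (quartic_lt_exp2 s64) w6 hw hlw Fk FF lL.
by rewrite inE ltnNge => /negbTE ->.
Qed.
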